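(* Let $(W,S)$ be a finite Coxeter system and let $a\in\Sigma^+(W)$, i.e. $a$ is a linear combination with non-negative rational coefficients of the basis elements $x_I$ ($I\subset S$) of the Solomon descent algebra $\Sigma(W)$. Then the minimal polynomial $f_a(T)\in\mathbb{Q}[T]$ of $a$ is square-free.
   Context: Let $(W,S)$ be a finite Coxeter system with length function $\ell$. For $I\subset S$, set $X_I=\{w\in W : \ell(ws)>\ell(w)\ \text{for all } s\in I\}$ and $x_I=\sum_{w\in X_I} w\in\mathbb{Q}W$. The Solomon descent algebra is $\Sigma(W)=\bigoplus_{I\subset S}\mathbb{Q}x_I$; it is a unital subalgebra of the group algebra $\mathbb{Q}W$, with basis $(x_I)_{I\subset S}$ (Solomon). $\Sigma^+(W)$ is the set of $a=\sum_{I\subset S}\xi_I(a)x_I\in\Sigma(W)$ with $\xi_I(a)\ge 0$ for all $I\subset S$. *)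

(* Defs.v *)
From HB Require Import structures.
From mathcomp Require Import all_boot all_order all_algebra all_fingroup all_field.

Set Implicit Arguments.
Unset Strict Implicit.
Unset Printing Implicit Defensive.

Import GroupScope GRing.Theory.

(* A finite Coxeter system, in Bourbaki's form: S is a set of involutions that
   generates W and (s t)^#[s t] = 1 (s, t in S) is a presentation of W.  For
   s = t the relation reads s^2 = 1.  The universal property ranges over all
   groups, finite or not. *)
Definition coxeter_system (W : finGroupType) (S : {set W}) : Prop :=
  [/\ <<S>> = [set: W],
      {in S, forall s, #[s] = 2}
    & forall (H : groupType) (f : W -> H),
        {in S &, forall s t, (f s * f t) ^+ #[s * t] = 1} ->
        exists phi : {multiplicative W -> H}, {in S, phi =1 f}].

Section Descents.

Variables (W : finGroupType) (S : {set W}).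

(* S ^+ n is the set of products of n elements of S.  The search may be bounded
   by #|W|: see coxeter_lengthP. *)
Definition coxeter_length (w : W) : nat :=
  find (fun n => w \in S ^+ n) (iota 0 #|W|).

Lemma mem_expgs n w :
  reflect (exists2 s : seq W, {subset s <= S} & size s = n /\ w = \prod_(x <- s) x)
          (w \in S ^+ n).
Proof.
apply: (iffP idP).
  elim: n w => [|n IHn] w.
    by rewrite expg0 => /set1P->; exists [::] => //; rewrite big_nil.
  rewrite expgS => /mulsgP[x y Sx /IHn[s sS [<- ->]] ->].
  exists (x :: s); last by rewrite big_cons.
  by move=> z; rewrite inE => /predU1P[-> | /sS].
case=> s sS [<- ->] {n w}; elim: s sS => [|x s IHs] sS.
  by rewrite big_nil expg0 set11.
rewrite big_cons /= expgS mem_mulg ?sS ?mem_head // IHs // => z sz.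
by rewrite sS // inE sz orbT.
Qed.

Lemma expgs_bound w n :
  w \in S ^+ n -> exists2 m, m < #|W| & (m <= n) && (w \in S ^+ m).
Proof.
case/mem_expgs=> s sS [<- ->] {n w}.
pose e := [rel x y : W | x^-1 * y \in S].
suff step s1 x0 : {subset s1 <= S} ->
    exists p, [/\ path e x0 p, last x0 p = x0 * \prod_(x <- s1) x
                 & size p = size s1].
  have [p [ep lp <-]] := step s 1 sS; rewrite mul1g in lp; rewrite -lp.
  case/shortenP: ep => q eq uq sub; exists (size q).
    by have /card_uniqP/= <- := uq; apply: max_card.
  have /uniq_leq_size -> //= : uniq q by case/andP: uq.
  suff /(_ q 1 eq)[t tS [st et]] : forall q x0, path e x0 q ->
      exists2 t : seq W, {subset t <= S} &
        size t = size q /\ x0^-1 * last x0 q = \prod_(x <- t) x.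
    by apply/mem_expgs; exists t => //; rewrite -et invg1 mul1g.
  elim=> [|y q1 IHq] x0 /=; first by exists [::]; rewrite // big_nil mulVg.
  case/andP=> exy /IHq[t tS [st et]]; exists (x0^-1 * y :: t) => [z|].
    by rewrite inE => /predU1P[-> | /tS].
  by rewrite /= st big_cons -et -mulgA mulKVg.
elim: s1 x0 => [|x s1 IHs] x0 s1S.
  by exists [::]; rewrite big_nil mulg1.
have [|p [ep lp sp]] := IHs (x0 * x).
  by move=> z sz; rewrite s1S // inE sz orbT.
exists (x0 * x :: p); split; rewrite /= ?sp //.
  by rewrite mulKg s1S ?mem_head.
by rewrite big_cons mulgA.
Qed.

Lemma coxeter_lengthP w : <<S>> = [set: W] ->
  w \in S ^+ coxeter_length w /\
  forall n, w \in S ^+ n -> coxeter_length w <= n.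
Proof.
move=> genS; have: w \in <<S>> by rewrite genS inE.
case/gen_prodgP=> n [c cS w_c].
have Sn : w \in S ^+ n.
  apply/mem_expgs; exists [seq c i | i <- enum 'I_n].
    by move=> _ /mapP[i _ ->].
  by rewrite size_map size_enum_ord big_map w_c -[index_enum _]enumT.
have le_len k : k < #|W| -> w \in S ^+ k -> coxeter_length w <= k.
  move=> ltk Sk; rewrite leqNgt; apply/negP=> /(before_find 0).
  by rewrite nth_iota // add0n Sk.
have [m ltm /andP[_ Sm]] := expgs_bound Sn.
have has_w : has (fun n => w \in S ^+ n) (iota 0 #|W|).
  by apply/hasP; exists m; rewrite ?mem_iota.
split.
  have:= nth_find 0 has_w; rewrite nth_iota ?add0n //.
  by rewrite has_find size_iota in has_w.
move=> k /expgs_bound[l ltl /andP[lelk Sl]].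
exact: leq_trans (le_len _ ltl Sl) lelk.
Qed.

Definition min_coset_reps (I : {set W}) : {set W} :=
  [set w | [forall s in I, coxeter_length w < coxeter_length (w * s)]].

End Descents.

Local Open Scope ring_scope.

(* The group algebra: functions W -> F with the convolution product. *)
Definition group_algebra (F : fieldType) (W : finGroupType) : Type :=
  {ffun W -> F^o}.

Section GroupAlgebra.

Variables (F : fieldType) (W : finGroupType).
Local Notation A := (group_algebra F W).
Implicit Types (a b c : A) (u v w : W).

HB.instance Definition _ := Vector.copy A {ffun W -> F^o}.

Definition galg_elt w : A := [ffun u => (u == w)%:R].

Definition galg_mul a b : A := [ffun w => \sum_u (a u : F) * b (u^-1 * w)%g].

Fact galg_mulA : associative galg_mul.
Proof.
move=> a b c; apply/ffunP=> w; rewrite !ffunE.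
transitivity (\sum_u \sum_v (a u : F) * (b (u^-1 * v)%g * c (v^-1 * w)%g)).
  apply: eq_bigr => u _; rewrite ffunE mulr_sumr.
  rewrite (reindex_inj (mulgI u^-1%g)) /=.
  by apply: eq_bigr => v _; rewrite invMg invgK -[(v^-1 * u * _)%g]mulgA mulKVg.
rewrite exchange_big; apply: eq_bigr => v _ /=.
by rewrite ffunE mulr_suml; apply: eq_bigr => u _; rewrite mulrA.
Qed.

Fact galg_mul1 : left_id (galg_elt 1%g) galg_mul.
Proof.
move=> a; apply/ffunP=> w; rewrite ffunE (bigD1 1%g) //= ffunE eqxx mul1r.
rewrite invg1 mul1g big1 ?addr0 // => u /negPf u1.
by rewrite ffunE u1 mul0r.
Qed.

Fact galg_mulr1 : right_id (galg_elt 1%g) galg_mul.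
Proof.
move=> a; apply/ffunP=> w; rewrite ffunE (bigD1 w) //= ffunE mulVg eqxx mulr1.
rewrite big1 ?addr0 // => u uw; rewrite ffunE -(inj_eq (mulgI u)) mulKVg mulg1.
by rewrite eq_sym (negPf uw) mulr0.
Qed.

Fact galg_mulDl : left_distributive galg_mul +%R.
Proof.
move=> a b c; apply/ffunP=> w; rewrite !ffunE -big_split /=.
by apply: eq_bigr => u _; rewrite ffunE mulrDl.
Qed.

Fact galg_mulDr : right_distributive galg_mul +%R.
Proof.
move=> a b c; apply/ffunP=> w; rewrite !ffunE -big_split /=.
by apply: eq_bigr => u _; rewrite ffunE mulrDr.
Qed.

Fact galg_1_neq0 : galg_elt 1%g != 0.
Proof. by apply/eqP=> /ffunP/(_ 1%g)/eqP; rewrite !ffunE eqxx oner_eq0. Qed.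

HB.instance Definition _ := GRing.Zmodule_isNzRing.Build A
  galg_mulA galg_mul1 galg_mulr1 galg_mulDl galg_mulDr galg_1_neq0.

Fact galg_scaleAl (k : F) a b : k *: (a * b) = k *: a * b.
Proof.
apply/ffunP=> w; rewrite !ffunE scaler_sumr.
by apply: eq_bigr => u _; rewrite ffunE scalerAl.
Qed.

HB.instance Definition _ := GRing.Lmodule_isLalgebra.Build F A galg_scaleAl.

Fact galg_scaleAr (k : F) a b : k *: (a * b) = a * (k *: b).
Proof.
apply/ffunP=> w; rewrite !ffunE scaler_sumr.
by apply: eq_bigr => u _; rewrite ffunE scalerAr.
Qed.

HB.instance Definition _ := GRing.Lalgebra_isAlgebra.Build F A galg_scaleAr.
HB.instance Definition _ := Algebra_isFalgebra.Build F A.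

Lemma galg_eltM u v : galg_elt (u * v)%g = galg_elt u * galg_elt v.
Proof.
apply/ffunP=> w; rewrite !ffunE (bigD1 u) //= !ffunE eqxx mul1r.
rewrite big1 ?addr0 => [|x /negPf xu]; last by rewrite ffunE xu mul0r.
by rewrite -(inj_eq (mulgI u) (u^-1 * w)%g) mulKVg.
Qed.

Lemma galg_sum a : a = \sum_w (a w : F) *: galg_elt w.
Proof.
apply/ffunP=> w; rewrite sum_ffunE (bigD1 w) //= !ffunE eqxx.
rewrite big1 => [|u uw]; first by rewrite addr0 [_ *: _]mulr1.
by rewrite !ffunE eq_sym (negPf uw) scaler0.
Qed.

End GroupAlgebra.

Section MinimalPolynomial.

Variables (F : fieldType) (A : falgType F) (a : A).

Let powers n := [tuple a ^+ i | i < n].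

Fact degree_minpoly_proof : exists n, a ^+ n \in <<powers n>>%VS.
Proof.
have [/existsP[n ?] | /existsPn no] :=
  boolP [exists n : 'I_(\dim {:A}).+1, a ^+ n \in <<powers n>>%VS].
  by exists n.
have dimS n : (n <= (\dim {:A}).+1)%N -> (n <= \dim <<powers n>>)%N.
  elim: n => // n IHn ltn; apply: leq_ltn_trans (IHn (ltnW ltn)) _.
  have subn : (<<powers n>> <= <<powers n.+1>>)%VS.
    apply/span_subvP=> _ /mapP[i _ ->]; apply: memv_span.
    by apply/mapP; exists (widen_ord (leqnSn n) i); rewrite ?mem_enum.
  rewrite ltnNge; apply/negP => le; have := no (Ordinal ltn) => /negP[] /=.
  have /eqP -> : <<powers n>>%VS == <<powers n.+1>>%VS by rewrite eqEdim subn le.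
  by apply: memv_span; apply/mapP; exists ord_max; rewrite ?mem_enum.
have := leq_trans (dimS _ (leqnn _)) (dimvS (subvf _)).
by rewrite ltnn.
Qed.

(* The least n such that a ^+ n is a linear combination of lower powers. *)
Definition degree_minpoly : nat := ex_minn degree_minpoly_proof.

Definition minpoly : {poly F} :=
  'X^degree_minpoly -
  \sum_(i < degree_minpoly)
     coord (powers degree_minpoly) i (a ^+ degree_minpoly) *: 'X^i.

Lemma size_minpoly : size minpoly = degree_minpoly.+1.
Proof.
rewrite /minpoly size_polyDl size_polyXn // size_polyN ltnS.
apply: leq_trans (size_sum _ _ _) _; apply/bigmax_leqP => i _.
by apply: leq_trans (size_scale_leq _ _) _; rewrite size_polyXn.
Qed.

Lemma minpoly_monic : minpoly \is monic.
Proof.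
rewrite monicE lead_coefE size_minpoly /= coefB coefXn eqxx coef_sum big1 ?subr0 //.
by move=> i _; rewrite coefZ coefXn gtn_eqF ?mulr0.
Qed.

Lemma minpoly_root : horner_alg a minpoly = 0.
Proof.
rewrite /minpoly /degree_minpoly; case: ex_minnP => d a_d _.
rewrite rmorphB rmorph_sum rmorphXn /= horner_algX.
rewrite {1}(coord_span a_d) -sumrB big1 // => i _.
rewrite linearZ /= rmorphXn /= horner_algX (nth_map i) ?size_enum_ord //.
by rewrite nth_ord_enum mulr_algl subrr.
Qed.

Lemma minpoly_min p : horner_alg a p = 0 -> minpoly %| p.
Proof.
move=> pa0; rewrite /dvdp; apply: contraT => r_neq0.
have ra0 : horner_alg a (p %% minpoly) = 0.
  move: pa0; rewrite {1}(Pdiv.IdomainMonic.divp_eq minpoly_monic p).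
  by rewrite rmorphD rmorphM /= minpoly_root mulr0 add0r.
set r := p %% minpoly in r_neq0 ra0.
have : (size r <= degree_minpoly)%N.
  by rewrite -ltnS -size_minpoly ltn_modp monic_neq0 ?minpoly_monic.
rewrite /degree_minpoly; case: ex_minnP => d _ min_d; rewrite leqNgt => /negP[].
case def_n: (size r) => [|n]; first by rewrite -size_poly_eq0 def_n in r_neq0.
rewrite ltnS; apply: min_d.
have lr_neq0 : r`_n != 0 by move: r_neq0; rewrite -lead_coef_eq0 lead_coefE def_n.
have : horner_alg a r = \sum_(i < n.+1) r`_i *: a ^+ i.
  rewrite -{1}[r]coefK poly_def def_n rmorph_sum; apply: eq_bigr => i _ /=.
  by rewrite linearZ /= rmorphXn /= horner_algX mulr_algl.
rewrite ra0 big_ord_recr /= => /eqP; rewrite eq_sym addrC addr_eq0 => /eqP def_an.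
rewrite -[a ^+ n](scalerK lr_neq0) def_an memvZ // memvN memv_suml // => i _.
by rewrite memvZ // memv_span //; apply/mapP; exists i; rewrite ?mem_enum.
Qed.

End MinimalPolynomial.

Definition squarefree_poly (F : fieldType) (p : {poly F}) : Prop :=
  forall q : {poly F}, size q != 1%N -> ~~ (q ^+ 2 %| p).

Section DescentAlgebra.

Variables (W : finGroupType) (S : {set W}).

Definition descent_elt (I : {set W}) : group_algebra rat W :=
  \sum_(w in min_coset_reps S I) galg_elt rat w.

(* The x_I (I \subset S) are linearly independent, so the coefficients xi I are
   the coordinates of a in the basis (x_I) of the descent algebra. *)
Definition descent_nonneg (a : group_algebra rat W) : Prop :=
  exists2 xi : {set W} -> rat,
    forall I : {set W}, I \subset S -> 0 <= xi I
    & a = \sum_(I : {set W} | I \subset S) xi I *: descent_elt I.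

End DescentAlgebra.

(* Main.v *)
Require Import Defs.
From mathcomp Require Import all_boot all_order all_algebra all_fingroup all_field.
From HB Require Import structures.

(** The right multiplication by [a] on the group algebra is triangular, and the
    non-negativity of the coefficients forces its eigenvalues to increase
    strictly along every non-zero off-diagonal entry; such an operator is
    diagonalizable.  This is the argument of K. Brown for random walks on left
    regular bands, applied to the faces of the Coxeter complex.

    Chambers are the elements of W, and the faces of type I are the cosets
    g <<I>>.  A face F acts on chambers by projection: [coset_proj] sends c to
    the chamber of F that is nearest to c.  Since c times the shortest element of
    c^-1 F is this chamber, c * x_I is the sum of the projections of c on all
    the faces of type I ([sum_coset_proj]).  Hence c * a is a combination of
    projections of c, with non-negative coefficients that do not depend on c.

    A chamber is determined by its inversions, that is, by the sides of the
    reflecting hyperplanes on which it lies ([inversions_inj]).  On the side of a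
    given hyperplane, the projection on F acts either trivially (if the
    hyperplane contains F) or as a constant: it is [sign_selective].  Maps of
    this kind are closed under composition, are idempotent, and satisfy
    x y z = x y as soon as x z = x.

    Let now x be a sign-selective map, extended linearly, and let the projections
    y occur in [a] with weights mu_y.  Then x(b a) is the sum of the mu_y (x y)(b),
    so x(b (a - ev x)) is the sum over the y with x y != x, where ev x is the sum
    of the mu_y with x y = x.  By the absorption property, every y that x absorbs
    is absorbed by x y, and so is y itself; hence ev (x y) > ev x whenever mu_y > 0
    and x y != x.  By induction the product of the T - r, over the distinct
    values r >= ev x of ev, evaluated at [a] and multiplied on the left by any b,
    is killed by x.  For x the identity this gives a polynomial with simple
    roots that annihilates [a].

    The inversions come from the presentation of W: it makes W act on
    W x {+1, -1} so that a generator s conjugates by s and changes the sign of s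
    only.  The sign part of this action is a cocycle ([inversion_cocycle]), and
    the strong exchange property is read off from its value on words. *)

Set Implicit Arguments.
Unset Strict Implicit.
Unset Printing Implicit Defensive.

Import GroupScope GRing.Theory Num.Theory Order.TTheory.

(** * Maps that keep or freeze each sign *)

Section SignSelective.

Variables (C T : Type) (eps : C -> T -> bool).

(** When [eps] gives the side of each hyperplane on which a chamber lies, these
    behave like the left multiplication by a face: the signs of the hyperplanes
    that contain the face are kept, the others become those of the face. *)
Definition sign_selective (x : C -> C) : Prop :=
  forall t, (forall c, eps (x c) t = eps c t)
         \/ (forall c d, eps (x c) t = eps (x d) t).

Lemma sign_selective_comp x y :
  sign_selective x -> sign_selective y -> sign_selective (x \o y).
Proof.
move=> selx sely t /=; have [xt|xt] := selx t; last by right=> c d; apply: xt.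
have [yt|yt] := sely t; first by left=> c; rewrite xt yt.
by right=> c d; rewrite !xt; apply: yt.
Qed.

Hypothesis eps_inj : forall c d, eps c =1 eps d -> c = d.

Lemma sign_selective_idem y : sign_selective y -> y \o y =1 y.
Proof.
move=> sely c; apply: eps_inj => t /=.
by have [yt|yt] := sely t; [rewrite yt | apply: yt].
Qed.

(** Left regular bands satisfy x y x = x y, whence x y z = x y x z = x y x = x y
    if x z = x.  Here the signs that x y keeps are kept by x, so z does not
    change them. *)
Lemma sign_selective_absorb x y z :
    sign_selective x -> sign_selective y ->
  x \o z =1 x -> x \o y \o z =1 x \o y.
Proof.
move=> selx sely xz c; apply: eps_inj => t /=.
have [xt|xt] := selx t; last exact: xt.
have [yt|yt] := sely t; last by rewrite !xt; apply: yt.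
by rewrite !xt !yt -(xt (z c)) [x _]xz xt.
Qed.

End SignSelective.

(** * Diagonalizability from strictly increasing eigenvalues *)

Lemma separable_squarefree (F : fieldType) (p : {poly F}) :
  separable_poly p -> squarefree_poly p.
Proof.
move=> /separable_polyP[cop _] q q_neq1; apply/negP; rewrite expr2 => /cop.
by rewrite coprimepp (negPf q_neq1).
Qed.

Local Open Scope ring_scope.

Section LinearExtension.

Variables (F : fieldType) (W : finGroupType).
Local Notation A := (group_algebra F W).

Definition linext (x : W -> W) (b : A) : A :=
  \sum_w (b w : F) *: galg_elt F (x w).

Fact linext_linear x : linear (linext x).
Proof.
move=> k b c; rewrite /linext scaler_sumr -big_split; apply: eq_bigr => w _ /=.
by rewrite !ffunE scalerDl scalerA.
Qed.

HB.instance Definition _ x :=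
  GRing.isLinear.Build F A A _ (linext x) (linext_linear x).

Lemma linext_elt x w : linext x (galg_elt F w) = galg_elt F (x w).
Proof.
rewrite /linext (bigD1 w) //= ffunE eqxx scale1r big1 ?addr0 // => u /negPf uw.
by rewrite ffunE uw scale0r.
Qed.

Lemma linext_id b : linext id b = b.
Proof. by rewrite [RHS]galg_sum. Qed.

Lemma eq_linext x y : x =1 y -> linext x =1 linext y.
Proof. by move=> xy b; apply: eq_bigr => w _; rewrite xy. Qed.

End LinearExtension.

Section Triangularity.

Variables (F : realFieldType) (W : finGroupType) (T : Type).
Variables (eps : W -> T -> bool).
Hypothesis eps_inj : forall c d, eps c =1 eps d -> c = d.

Variables (J : finType) (P : pred J) (mu : J -> F) (p : J -> W -> W).
Hypothesis mu_ge0 : forall j, P j -> 0 <= mu j.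
Hypothesis p_selective : forall j, P j -> sign_selective eps (p j).

Variable a : group_algebra F W.
Hypothesis elt_mul_a :
  forall c, galg_elt F c * a = \sum_(j | P j) mu j *: galg_elt F (p j c).

Let after (x : {ffun W -> W}) j : {ffun W -> W} := [ffun c => x (p j c)].

Let ev (x : {ffun W -> W}) : F := \sum_(j | P j && (after x j == x)) mu j.

Let after_selective (x : {ffun W -> W}) j :
  sign_selective eps x -> P j -> sign_selective eps (after x j).
Proof.
move=> selx Pj t; have [xt|xt] := sign_selective_comp selx (p_selective Pj) t.
  by left=> c; rewrite -[in RHS]xt ffunE.
by right=> c d; rewrite !ffunE; apply: xt.
Qed.

Let after_fixes (x : {ffun W -> W}) j k :
    sign_selective eps x -> P j -> after x k == x ->
  after (after x j) k == after x j.
Proof.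
move=> selx Pj /eqP xk; apply/eqP/ffunP=> c; rewrite !ffunE.
apply: (sign_selective_absorb eps_inj selx (p_selective Pj)) => d /=.
by rewrite -[in RHS]xk ffunE.
Qed.

Let after_idem (x : {ffun W -> W}) j : P j -> after (after x j) j == after x j.
Proof.
move=> Pj; apply/eqP/ffunP=> c; rewrite !ffunE.
by congr (x _); apply: (sign_selective_idem eps_inj (p_selective Pj)).
Qed.

(** The non-negativity of the weights is used here: the terms of [ev x] all
    occur in [ev (after x j)], together with the positive term [mu j]. *)
Let ev_after (x : {ffun W -> W}) j :
    sign_selective eps x -> P j -> after x j != x -> 0 < mu j ->
  ev x < ev (after x j).
Proof.
move=> selx Pj xj mu_j; rewrite /ev [ltRHS](bigID (fun k => after x k == x)) /=.
have -> : \sum_(k | P k && (after (after x j) k == after x j)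
                     && (after x k == x)) mu k = ev x.
  apply: eq_bigl => k; rewrite -andbA; case: (boolP (after x k == x)) => xk.
    by rewrite (after_fixes selx Pj xk).
  by rewrite !andbF.
rewrite ltrDl (bigD1 j) /=; last by rewrite Pj after_idem.
rewrite ltr_pwDl // sumr_ge0 // => k /andP[/andP[/andP[Pk _] _] _].
exact: mu_ge0.
Qed.

Let linext_mul_a (x : {ffun W -> W}) b :
  linext x (b * a) = \sum_(j | P j) mu j *: linext (after x j) b.
Proof.
rewrite {1}[b]galg_sum mulr_suml linear_sum /=.
transitivity (\sum_c \sum_(j | P j)
    mu j *: ((b c : F) *: galg_elt F (x (p j c)))).
  apply: eq_bigr => c _.
  rewrite -scalerAl linearZ /= elt_mul_a (linear_sum (linext x)) /= scaler_sumr.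
  by apply: eq_bigr => j _; rewrite linearZ /= linext_elt !scalerA mulrC.
rewrite exchange_big /=; apply: eq_bigr => j _.
by rewrite /linext scaler_sumr; apply: eq_bigr => c _; rewrite ffunE.
Qed.

Let spectrum : seq F := undup (codom ev).
Let upper (c : F) : {poly F} := \prod_(r <- spectrum | c <= r) ('X - r%:P).
Let above (c : F) : {poly F} := \prod_(r <- spectrum | c < r) ('X - r%:P).

Let upperE x : upper (ev x) = above (ev x) * ('X - (ev x)%:P).
Proof.
rewrite mulrC /upper -big_filter (bigD1_seq (ev x)) ?filter_uniq ?undup_uniq //=.
  rewrite big_filter_cond; congr (_ * _); apply: eq_bigl => r.
  by rewrite lt_neqAle eq_sym andbC.
by rewrite mem_filter lexx mem_undup codom_f.
Qed.

Let above_upper c d : c < d -> exists q, above c = q * upper d.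
Proof.
move=> ltcd; exists (\prod_(r <- spectrum | (c < r) && ~~ (d <= r)) ('X - r%:P)).
rewrite mulrC /above (bigID (fun r => d <= r)) /=; congr (_ * _).
by apply: eq_bigl => r; case: (leP d r) => [/(lt_le_trans ltcd)->|]; rewrite ?andbF.
Qed.

(** After division by the last factor T - ev x, only maps [after x j] with a
    larger eigenvalue remain, and [above (ev x)] contains all their factors.  The
    induction is on the number of projections that x does not absorb. *)
Let linext_upper (x : {ffun W -> W}) b :
  sign_selective eps x -> linext x (b * horner_alg a (upper (ev x))) = 0.
Proof.
have [n] := ubnP #|[pred j | P j && (after x j != x)]|.
elim: n x b => // n IHn x b lexn selx.
rewrite upperE rmorphM rmorphB /= horner_algX horner_algC mulrA mulrBr.
set b' := b * _; rewrite mulr_algr linearB linearZ /= linext_mul_a.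
rewrite (bigID (fun j => after x j == x)) /=.
under eq_bigr => j /andP[_ /eqP->] do [].
rewrite -scaler_suml addrAC subrr add0r big1 // => j /andP[Pj xj].
have := mu_ge0 Pj; rewrite le_eqVlt => /predU1P[<-|mu_j]; first by rewrite scale0r.
have ltev := ev_after selx Pj xj mu_j.
have [q def_q] := above_upper ltev.
rewrite /b' def_q rmorphM /= mulrA IHn ?scaler0 //; last exact: after_selective.
rewrite ltnS in lexn; apply: leq_trans lexn; apply/proper_card/properP; split.
  apply/subsetP=> k; rewrite !inE => /andP[-> /=]; apply: contra.
  exact: after_fixes.
by exists j; rewrite !inE Pj // after_idem.
Qed.

(** Any element that acts on the right as a non-negative combination of
    sign-selective maps of the basis is diagonalizable. *)
Theorem selective_minpoly_squarefree : squarefree_poly (minpoly a).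
Proof.
pose x : {ffun W -> W} := [ffun c => c].
have selx : sign_selective eps x by move=> t; left=> c; rewrite ffunE.
apply: separable_squarefree.
apply: (dvdp_separable (p := upper (ev x))).
  apply: minpoly_min; rewrite -[LHS]mul1r -[LHS]linext_id.
  rewrite -[RHS](linext_upper 1 selx); apply: eq_linext => c.
  by rewrite ffunE.
rewrite /upper -big_filter separable_prod_XsubC.
by rewrite filter_uniq ?undup_uniq.
Qed.

End Triangularity.

Local Close Scope ring_scope.

(** * The inversion cocycle of a Coxeter system *)

Section InversionCocycle.

Variables (W : finGroupType) (S : {set W}).

(** For a reflection t, [eps w t] says that the hyperplane of t separates the
    chambers 1 and w, i.e. that t w is shorter than w.  It is false when t is not
    a reflection, which makes it harmless to let t range over the whole group. *)
Definition inversion_cocycle (eps : W -> W -> bool) : Prop :=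
  {in S, forall s t, eps s t = (t == s)} /\
  (forall u v t, eps (u * v) t = eps u t (+) eps v (t ^ u)).

(** Products of permutations are applied from left to right, in accordance with
    t ^ (u * v) = (t ^ u) ^ v.  A word in S then flips the sign of t each time that
    the conjugate of t by a prefix is equal to the letter after this prefix. *)
Definition flip_fun (s : W) (tb : W * bool) : W * bool :=
  (tb.1 ^ s, tb.2 (+) (tb.1 == s)).

Fact flip_fun_inj s : injective (flip_fun s).
Proof.
by case=> t b [r d] [/conjg_inj <-] /addIb <-.
Qed.

Definition flip s : {perm W * bool} := perm (@flip_fun_inj s).

Lemma flipE s t b : flip s (t, b) = (t ^ s, b (+) (t == s)).
Proof. by rewrite permE. Qed.

(** Let d = s t, of order m.  The j-th letter of the word (s t)^m, 0 <= j < 2m,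
    flips the sign of r exactly when r = d^j s.  As d^m = 1, the letters j and
    j + m flip the same sign, so no sign changes in the end. *)
Lemma flip_braid s t : #[s] = 2 -> #[t] = 2 ->
  (flip s * flip t) ^+ #[s * t] = 1.
Proof.
move=> s2 t2.
have sV : s^-1 = s by apply/eqP; rewrite eq_invg_mul -expg2 -s2 expg_order.
have tV : t^-1 = t by apply/eqP; rewrite eq_invg_mul -expg2 -t2 expg_order.
pose d := s * t.
have ds n : (d ^+ n) ^ s = d ^- n.
  by rewrite conjXg -expgVn /d invMg sV tV conjgE sV !mulgA -{1}sV mulVg mul1g.
have dual n : s * d ^- n = d ^+ n * s by rewrite -ds conjgE mulKVg.
have step n r b : ((flip s * flip t) ^+ n) (r, b) =
    (r ^ (d ^+ n), b (+) odd (\sum_(j < n.*2) (r == (d ^+ j * s)%g))).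
  elim: n => [|n IHn]; first by rewrite !expg0 perm1 big_ord0 conjg1 addbF.
  rewrite expgSr permM IHn permM !flipE -!conjgM /= doubleS !big_ord_recr /=.
  rewrite -expgSr !oddD !oddb !addbA.
  rewrite !(can2_eq (conjgK _) (conjgKV _)) !(conjgE s) !(conjgE t) !invgK.
  congr (_, _ (+) _ (+) _); congr (_ == _); first by rewrite dual mulgA -expgD addnn.
  rewrite invMg sV mulgA -[_ * s * t]mulgA -/d -expgSr dual mulgA -expgD.
  by rewrite addSn addnn.
apply/permP=> -[r b]; rewrite step -/d expg_order conjg1 perm1; congr (_, _).
rewrite -addnn big_split_ord /=.
under [X in _ + X]eq_bigr => j _ do rewrite expgD expg_order mul1g.
by rewrite addnn odd_double addbF.
Qed.

Lemma inversion_cocycle_exists :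
  coxeter_system S -> exists eps, inversion_cocycle eps.
Proof.
case=> genS S2 univ.
have [s t Ss St|phi phiS] := univ {perm W * bool} flip.
  by rewrite flip_braid ?S2.
exists (fun w t => (phi w (t, false)).2).
have phiE w t b : phi w (t, b) = (t ^ w, b (+) (phi w (t, false)).2).
  have: w \in <<S>> by rewrite genS inE.
  case/gen_prodgP=> n [c cS ->]; elim: n c cS t b => [|n IHn] c cS t b.
    have phi1 : phi 1 = 1 by apply: (mulgI (phi 1)); rewrite -gmulfM !mulg1.
    by rewrite big_ord0 phi1 !perm1 conjg1 addbF.
  rewrite big_ord_recl gmulfM !permM (phiS (c ord0)) // !flipE IHn // [in RHS]IHn //=.
  by rewrite conjgM addbA.
split=> [s t Ss | u v t]; first by rewrite phiS // flipE.
by rewrite gmulfM permM [in LHS]phiE phiE.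
Qed.

End InversionCocycle.

(** * Exchange property and parabolic cosets *)

Section Inversions.

Variables (W : finGroupType) (S : {set W}).
Hypothesis genS : <<S>> = [set: W].
Hypothesis S2 : {in S, forall s, #[s] = 2}.
Variable eps : W -> W -> bool.
Hypothesis epsP : inversion_cocycle S eps.
Local Notation len := (coxeter_length S).

Let epsS s t : s \in S -> eps s t = (t == s).
Proof. by case: epsP => + _ => /[apply]. Qed.

Let epsM u v t : eps (u * v) t = eps u t (+) eps v (t ^ u).
Proof. by case: epsP. Qed.

Let eps1 t : eps 1 t = false.
Proof. by have := epsM 1 1 t; rewrite mulg1 conjg1; case: eps. Qed.

Let SS s : s \in S -> s * s = 1.
Proof. by move=> Ss; rewrite -expg2 -(S2 Ss) expg_order. Qed.

Let gen_word (I : {set W}) u : u \in <<I>> ->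
  exists2 q : seq W, {subset q <= I} & u = \prod_(x <- q) x.
Proof.
case/gen_prodgP=> n [c cI ->]; exists [seq c i | i <- enum 'I_n].
  by move=> _ /mapP[i _ ->].
by rewrite big_map -[index_enum _]enumT.
Qed.

Lemma inversion_letter (q : seq W) t :
    {subset q <= S} -> eps (\prod_(x <- q) x) t ->
  exists q1 s q2, q = q1 ++ s :: q2 /\ t ^ (\prod_(x <- q1) x) = s.
Proof.
elim: q t => [|s q IHq] t sS; first by rewrite big_nil eps1.
have Ss : s \in S by rewrite sS ?mem_head.
rewrite big_cons epsM epsS //; case: eqP => [-> _ | _ /= /IHq[]].
- by exists [::], s, q; rewrite big_nil conjg1.
- by move=> x qx; rewrite sS // inE qx orbT.
move=> q1 [x [q2 [-> tx]]]; exists (s :: q1), x, q2.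
by rewrite big_cons conjgM.
Qed.

(** If q = q1 s q2 and t = q1 s q1^-1, then t q = q1 s s q2 = q1 q2. *)
Lemma strong_exchange (q : seq W) t :
    {subset q <= S} -> eps (\prod_(x <- q) x) t ->
  exists r : seq W, [/\ {subset r <= q}, (size r).+1 = size q
                      & t * \prod_(x <- q) x = \prod_(x <- r) x].
Proof.
move=> qS /(inversion_letter qS)[q1 [s [q2 [def_q ts]]]].
have s2 : s * s = 1 by apply/SS/qS; rewrite def_q mem_cat mem_head orbT.
exists (q1 ++ q2); rewrite def_q; split.
- by move=> x; rewrite !mem_cat inE => /orP[-> | ->]; rewrite ?orbT.
- by rewrite !size_cat addnS.
by rewrite !big_cat big_cons /= mulgA (conjgC t) ts -mulgA (mulgA s) s2 mul1g.
Qed.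

Lemma inversion_shorter t w : eps w t -> len (t * w) < len w.
Proof.
have [/mem_expgs[q qS [<- ->]] _] := coxeter_lengthP w genS.
case/(strong_exchange qS)=> r [rq <- ->]; rewrite ltnS.
have [_ -> //] := coxeter_lengthP (\prod_(x <- r) x) genS.
by apply/mem_expgs; exists r => // x /rq/qS.
Qed.

(** Right descents are expressed with left inversions: w s = t w where t is the
    reflection w s w^-1. *)
Lemma descentE w s : s \in S -> (len w < len (w * s)) = ~~ eps w (s ^ w^-1).
Proof.
move=> Ss; have ts : s ^ w^-1 * w = w * s by rewrite -conjgCV.
have [desc | ascent] := boolP (eps w _).
  by have := inversion_shorter desc; rewrite ts => lt_ws; rewrite ltnNge ltnW.
have : eps (w * s) (s ^ w^-1) by rewrite epsM (negPf ascent) conjgKV epsS ?eqxx.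
by move/inversion_shorter; rewrite mulgA ts -mulgA SS ?mulg1.
Qed.

Lemma min_coset_repsE (I : {set W}) w : I \subset S ->
  reflect {in I, forall s, ~~ eps w (s ^ w^-1)} (w \in min_coset_reps S I).
Proof.
move=> /subsetP IS; rewrite inE; apply: (iffP forall_inP) => hw s Is.
  by rewrite -descentE ?hw ?IS.
by rewrite descentE ?hw ?IS.
Qed.

(** The last letter of a shortest word in I is a descent, by the exchange
    property.  The words considered have all their letters in I, and deleting a
    letter keeps them so; the induction is on the length of such words. *)
Lemma no_descent_eq1 (I : {set W}) u : I \subset S ->
  u \in <<I>> -> {in I, forall s, ~~ eps u (s ^ u^-1)} -> u = 1.
Proof.
move=> /subsetP IS /gen_word[q qI def_u]; have [n] := ubnP (size q).
elim: n q qI def_u => // n IHn q; case/lastP: q => [|q s] qI def_u.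
  by rewrite def_u big_nil.
rewrite size_rcons ltnS => leqn noD.
have Is : s \in I by rewrite qI // mem_rcons mem_head.
have qI' : {subset q <= I} by move=> x qx; rewrite qI // mem_rcons inE qx orbT.
pose v := \prod_(x <- q) x; have {}def_u : u = v * s by rewrite def_u big_rcons.
have ss : s * s = 1 by rewrite SS ?IS.
have def_v : v = u * s by rewrite def_u -mulgA ss mulg1.
have : eps v (s ^ u^-1).
  have := noD s Is; rewrite {1}def_u epsM def_v conjgM conjgKV.
  by rewrite (conjgE s s) mulKg (epsS _ (IS _ Is)) eqxx addbT negbK.
case/strong_exchange=> [x /qI'/IS //|r [rq size_r]].
rewrite -/v def_v mulgA -conjgCV -mulgA ss mulg1.
move=> def_ur; apply: (IHn r) noD => //; first by move=> x /rq/qI'.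
by rewrite (leq_trans _ leqn) // -size_r.
Qed.

(** Two chambers on the same side of every hyperplane differ by an element
    without descents. *)
Lemma inversions_inj c d : eps c =1 eps d -> c = d.
Proof.
move=> cd; apply/eqP; rewrite eq_mulVg1; apply/eqP.
apply: (no_descent_eq1 (subxx S)) => [|s Ss]; first by rewrite genS inE.
have := epsM c (c^-1 * d) ((s ^ (c^-1 * d)^-1) ^ c^-1).
by rewrite mulKVg conjgKV -cd; case: (eps c _); case: (eps (c^-1 * d) _).
Qed.

(** An inversion of a word in I is conjugate to one of its letters by the prefix
    that precedes it. *)
Lemma parabolic_inversion (I : {set W}) u t :
  I \subset S -> u \in <<I>> -> eps u t -> t \in <<I>>.
Proof.
move=> /subsetP IS /gen_word[q qI ->] /inversion_letter[x /qI/IS //|].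
move=> q1 [s [q2 [def_q ts]]].
have q1I : \prod_(x <- q1) x \in <<I>>.
  rewrite big_seq; apply: group_prod => x q1x.
  by rewrite mem_gen // qI // def_q mem_cat q1x.
rewrite -(groupJr _ q1I) ts mem_gen // qI // def_q mem_cat mem_head orbT //.
Qed.

Definition min_rep (I : {set W}) g := [arg min_(m < g in g *: <<I>>) len m].

Lemma min_rep_coset I g : min_rep I g \in g *: <<I>>.
Proof. by rewrite /min_rep; case: arg_minnP; rewrite ?lcoset_refl. Qed.

(** An inversion m t m^-1 of m makes m t shorter than m; for t in <<I>> this is
    impossible, since m t stays in the coset where m is shortest. *)
Lemma min_rep_inversion I g t :
  t \in <<I>> -> eps (min_rep I g) (t ^ (min_rep I g)^-1) = false.
Proof.
rewrite /min_rep; case: arg_minnP; rewrite ?lcoset_refl // => m mF min_m It.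
apply/negP=> /inversion_shorter; rewrite -conjgCV ltnNge min_m //.
by case/lcosetP: mF => u Iu ->; rewrite -mulgA mem_lcoset mulKg groupM.
Qed.

Lemma min_rep_mem (I : {set W}) g :
  I \subset S -> min_rep I g \in min_coset_reps S I.
Proof.
move=> IS; apply/min_coset_repsE => // s Is.
by rewrite min_rep_inversion // mem_gen.
Qed.

(** Writing w = m u with m the shortest element of the coset, the cocycle shows
    that u has the same descents in I as w, hence none. *)
Lemma min_rep_unique (I : {set W}) g w : I \subset S ->
  w \in min_coset_reps S I -> w \in g *: <<I>> -> w = min_rep I g.
Proof.
move=> IS /(min_coset_repsE _ IS) noD; set m := min_rep I g => wF.
pose u := m^-1 * w; have def_w : w = m * u by rewrite mulKVg.
have Iu : u \in <<I>>.
  have := min_rep_coset I g; rewrite -/m => /lcosetP[v Iv def_m].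
  by rewrite /u def_m invMg -mulgA groupM ?groupV // -mem_lcoset.
suff u1 : u = 1 by rewrite def_w u1 mulg1.
apply: (no_descent_eq1 IS Iu) => s Is; have := noD s Is.
rewrite {1}def_w epsM {2}def_w invMg conjgM conjgKV.
rewrite def_w invMg conjgM [eps m _]min_rep_inversion //.
by rewrite groupJ ?groupV // mem_gen.
Qed.

(** The projection on the face g <<I>>, by translation of the case c = 1, where
    it is the shortest element of the coset. *)
Definition coset_proj I g c := c * min_rep I (c^-1 * g).

Lemma coset_proj_mem I g c : coset_proj I g c \in g *: <<I>>.
Proof.
have /lcosetP[u Iu def_m] := min_rep_coset I (c^-1 * g).
by rewrite /coset_proj def_m !mulgA mulgV mul1g mem_lcoset mulKg.
Qed.

(** A reflection t fixes the face g <<I>> when t ^ g is in <<I>>; its hyperplane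
    then does not separate c from its projection.  Otherwise the whole face lies
    on one side of the hyperplane. *)
Lemma coset_proj_selective (I : {set W}) g :
  I \subset S -> sign_selective eps (coset_proj I g).
Proof.
move=> IS t; have [It|nIt] := boolP (t ^ g \in <<I>>).
  left=> c; rewrite /coset_proj epsM; set m := min_rep _ _.
  have /lcosetP[u Iu def_y] := coset_proj_mem I g c.
  have -> : t ^ c = (t ^ (c * m)) ^ m^-1 by rewrite -conjgM mulgK.
  rewrite [eps m _]min_rep_inversion ?addbF //.
  by rewrite [c * m]def_y conjgM groupJ.
right=> c d; suff epsF x : x \in g *: <<I>> -> eps x t = eps g t.
  by rewrite !epsF ?coset_proj_mem.
case/lcosetP=> u Iu ->; rewrite epsM.
have [/(parabolic_inversion IS Iu)|_] := boolP (eps u _); last by rewrite addbF.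
by rewrite (negPf nIt).
Qed.

(** The translations by c permute the faces of type I, which are indexed by
    their shortest elements; this makes the indices [w] on both sides correspond
    to each other. *)
Lemma sum_coset_proj (V : nmodType) (f : W -> V) (I : {set W}) c : I \subset S ->
  (\sum_(w in min_coset_reps S I) f (c * w)%g
     = \sum_(w in min_coset_reps S I) f (coset_proj I w c))%R.
Proof.
move=> IS; pose m g := min_rep I g.
have mK g w : w \in min_coset_reps S I -> m (g * m (g^-1 * w)) = w.
  move=> XIw; apply/esym/min_rep_unique => //.
  have /lcosetP[u Iu def_m] := min_rep_coset I (g^-1 * w).
  by rewrite /m def_m !mulgA mulgV mul1g mem_lcoset invMg mulgKV groupV.
rewrite (reindex_onto (fun w => m (c^-1 * w)) (fun w => m (c * w))) /=.
  apply: eq_bigl => w; rewrite min_rep_mem //=; apply/eqP/idP => [<-|/mK //].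
  exact: min_rep_mem.
by move=> w /(mK c^-1); rewrite invgK.
Qed.

End Inversions.

(** * Non-negative elements of the descent algebra *)

Theorem proposition3p10 (W : finGroupType) (S : {set W})
    (a : group_algebra rat W) :
  coxeter_system S -> descent_nonneg S a -> squarefree_poly (minpoly a).
Proof.
move=> coxS [xi xi_ge0 def_a]; have [genS S2 _] := coxS.
have [eps epsP] := inversion_cocycle_exists coxS.
pose face (Iw : {set W} * W) :=
  (Iw.1 \subset S) && (Iw.2 \in min_coset_reps S Iw.1).
apply: (selective_minpoly_squarefree (inversions_inj genS S2 epsP)
  (P := face) (mu := fun Iw => xi Iw.1)
  (p := fun Iw => coset_proj S Iw.1 Iw.2)) => [[I w]|[I w]|c] /=.
- by case/andP=> IS _; apply: xi_ge0.
- by case/andP=> IS _; apply: coset_proj_selective.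
rewrite def_a mulr_sumr -(pair_big_dep (fun I : {set W} => I \subset S)
  (fun I w => w \in min_coset_reps S I)
  (fun I w => xi I *: galg_elt rat (coset_proj S I w c))%R) /=.
apply: eq_bigr => I IS; rewrite -scalerAr mulr_sumr -scaler_sumr.
rewrite -(sum_coset_proj genS S2 epsP (@galg_elt rat W)) //; congr (_ *: _)%R.
by apply: eq_bigr => w _; rewrite galg_eltM.
Qed.
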